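(* Let $\mathbb{F}_q$ be a finite field, let $G\subseteq\mathbb{F}_q^\ast$ be a multiplicative subgroup of order $r$, and let $\mathcal{A}=\beta G$ for some $\beta\in\mathbb{F}_q^\ast$. Assume that $p:=\operatorname{char}(\mathbb{F}_q)$ divides $r-1$. Choose $\mu\in\mathbb{F}_q^\ast$ and arbitrary nonzero scalars $u_\alpha\in\mathbb{F}_q^\ast$ for $\alpha\in\mathcal{A}$. Define the multiplier matrix $V\in(\mathbb{F}_q^\ast)^{2\times r}$, with columns indexed by the evaluation points $\alpha\in\mathcal{A}$, by \[ v_{1,\alpha}=u_\alpha,\qquad v_{2,\alpha}=\mu\alpha^2u_\alpha^{-1}. \] Then the HRS code $C=\operatorname{HRS}_r(\mathcal{A},V,2,r)$ is reverse self-dual.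
   Context: For an integer $h\ge 0$, $\mathcal{P}_{<h}=\{f\in\mathbb{F}_q[x]:\deg f<h\}$. Hasse derivative: for $f(x)=\sum_\ell f_\ell x^\ell\in\mathbb{F}_q[x]$ and $j\ge0$, $\partial^{(j)}f(x)=\sum_{\ell}\binom{\ell}{j}f_\ell x^{\ell-j}$ (with $\binom{\ell}{j}=0$ if $j>\ell$). Hyperderivative Reed–Solomon (HRS) code: for a set $\mathcal{A}=\{\alpha_1,\ldots,\alpha_r\}$ of $r$ distinct elements of $\mathbb{F}_q$, $V=(v_{i,j})\in(\mathbb{F}_q^\ast)^{s\times r}$ (one may index columns by the points $\alpha\in\mathcal{A}$ themselves) and $0\le k\le rs$, \[ \operatorname{HRS}_k(\mathcal{A},V,s,r)=\left\{\bigl(v_{i,j}\,\partial^{(i-1)}f(\alpha_j)\bigr)_{1\le i\le s,\,1\le j\le r}: f\in\mathcal{P}_{<k}\right\}\subseteq\operatorname{Mat}_{s\times r}(\mathbb{F}_q). \] Reverse bilinear form on $\operatorname{Mat}_{s\times r}(\mathbb{F}_q)$: $[A,B]_{\rm rev}=\sum_{j=1}^r\sum_{i=1}^s a_{i,j}b_{s-i+1,j}$. The reverse dual of a linear code $C$ is $C^{\perp_{\rm rev}}=\{B:[A,B]_{\rm rev}=0\text{ for all }A\in C\}$, and $C$ is reverse self-dual if $C=C^{\perp_{\rm rev}}$. *)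

(* Defs.v *)
From mathcomp Require Import all_boot all_order all_algebra all_fingroup all_field.
Set Implicit Arguments.
Unset Strict Implicit.
Unset Printing Implicit Defensive.

Import GRing.Theory.
Local Open Scope ring_scope.

(* Row indices are 0-based. [nderivn i], i.e. [f^`N(i)], is the i-th Hasse
   derivative, and [{poly_k F}] is the type of polynomials of degree < k.
   The evaluation set is given through an enumeration [alpha]. *)
Definition HRS_word (F : finFieldType) (s r : nat) (alpha : 'I_r -> F)
    (V : 'M[F]_(s, r)) (f : {poly F}) : 'M[F]_(s, r) :=
  \matrix_(i < s, j < r) (V i j * (f^`N(i)).[alpha j]).

(* Meant for injective [alpha], [V] without zero entries and k <= r * s. *)
Definition HRS (F : finFieldType) (s r k : nat) (alpha : 'I_r -> F)
    (V : 'M[F]_(s, r)) : {set 'M[F]_(s, r)} :=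
  [set HRS_word alpha V (f : {poly F}) | f : {poly_k F}].

(* With 0-based rows, [rev_ord] maps i to s - 1 - i. *)
Definition rev_form (F : finFieldType) (s r : nat) (A B : 'M[F]_(s, r)) : F :=
  \sum_(j < r) \sum_(i < s) A i j * B (rev_ord i) j.

Definition rev_dual (F : finFieldType) (s r : nat) (C : {set 'M[F]_(s, r)}) :
    {set 'M[F]_(s, r)} :=
  [set B | [forall A in C, rev_form A B == 0]].

Definition rev_self_dual (F : finFieldType) (s r : nat)
    (C : {set 'M[F]_(s, r)}) : Prop :=
  C = rev_dual C.

(* Main.v *)
Require Import Defs.
From HB Require Import structures.
From mathcomp Require Import all_boot all_order all_algebra all_fingroup all_field.
From mathcomp Require Import cyclic zify ring.
Import GRing.Theory.
Local Open Scope ring_scope.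

(** The pairing of the codewords of f and g is mu * \sum_a a^2 (fg)'(a), a
combination of the power sums \sum_a a^(n+1) with coefficients n * (fg)_n for
n <= 2r - 2. Over a coset of a group of order r such a power sum vanishes
unless r divides n + 1, i.e. n = r - 1, and then n = 0 in F. So the code is
isotropic; as evaluation at r points is injective on polynomials of degree < r,
its dimension r is half that of the ambient space. *)

Local Notation rev_rows := (rowsub (@rev_ord _)).

(** Turns the form into a dot product of flattened matrices, so that duals become kernels and ranks
    can be compared. *)
Lemma rev_formE (F : finFieldType) (s m : nat) (A B : 'M[F]_(s, m)) :
  rev_form A B = (mxvec A *m (mxvec (rev_rows B))^T) 0 0.
Proof.
rewrite mxE (reindex _ (curry_mxvec_bij s m)) /rev_form exchange_big pair_big.
by apply: eq_bigr => -[i j] _ /=; rewrite mxE !mxvecE mxE.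
Qed.

(** Dimension count: up to flattening and row reversal the dual is [kermx M^T], of rank
    [s * m - n <= n]. Isotropy puts the rank-[n] row space of [N] inside it, so the two coincide. *)
Lemma rev_self_dual_image (F : finFieldType) (s m n : nat)
    (f : {linear 'rV[F]_n -> 'M[F]_(s, m)}) :
  (s * m <= n + n)%N -> injective f ->
  (forall u v, rev_form (f u) (f v) = 0) ->
  rev_self_dual [set f u | u : 'rV_n].
Proof.
move=> le_sm f_inj f_iso.
have J_inj : injective (fun B : 'M[F]_(s, m) => rev_rows B).
  move=> A B eqJ; apply/matrixP => i j.
  by move/matrixP/(_ (rev_ord i) j): eqJ; rewrite !mxE rev_ordK.
pose M := lin1_mx (mxvec \o f); pose N := lin1_mx (mxvec \o (rev_rows \o f)).
have ME u : u *m M = mxvec (f u) by rewrite mul_rV_lin1.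
have NE u : u *m N = mxvec (rev_rows (f u)) by rewrite mul_rV_lin1.
have M_free : \rank M = n.
  apply/eqP/inj_row_free => u; rewrite ME => /(canRL mxvecK).
  by rewrite linear0 => fu0; apply: f_inj; rewrite linear0.
have N_free : \rank N = n.
  apply/eqP/inj_row_free => u; rewrite NE => /(canRL mxvecK).
  rewrite linear0 => Jfu0; apply: f_inj; apply: J_inj.
  by rewrite linear0 Jfu0 linear0.
have NM0 : N *m M^T = 0.
  apply/matrixP => i j; rewrite [RHS]mxE.
  (* This entry pairs the images under [f] of the basis vectors ['e_j] and ['e_i]. *)
  have -> : (N *m M^T) i j =
      (('e_j : 'rV_n) *m M *m (('e_i : 'rV_n) *m N)^T) 0 0.
    rewrite -!rowE !mxE; apply: eq_bigr => k _.
    by rewrite !mxE mulrC.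
  by rewrite ME NE -rev_formE f_iso.
have kerM : (kermx M^T <= N)%MS.
  have NK : (N <= kermx M^T)%MS by apply/sub_kermxP.
  (* If the inclusion were strict, the ranks would give [n < s * m - n], against [le_sm]. *)
  have := mxrank_leqif_sup NK => /leqifP; case: ifP => // _.
  by rewrite mxrank_ker mxrank_tr M_free N_free ltn_subRL ltnNge le_sm.
apply/setP => B; rewrite inE; apply/imsetP/'forall_implyP.
  by case=> u _ -> A /imsetP[v _ ->]; rewrite f_iso.
move=> dualB; have : (mxvec (rev_rows B) <= kermx M^T)%MS.
  apply/sub_kermxP/matrixP => i j; rewrite ord1 [RHS]mxE.
  have /dualB/eqP : f 'e_j \in [set f u | u : 'rV_n] by exact: imset_f.
  rewrite rev_formE -ME -rowE => <-; rewrite !mxE; apply: eq_bigr => k _.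
  by rewrite !mxE mulrC.
move/submx_trans => /(_ _ _ kerM) /submxP[u]; rewrite NE.
by move/(can_inj mxvecK)/J_inj => ->; exists u.
Qed.

Lemma HRS_word_is_linear (F : finFieldType) (s r : nat) (alpha : 'I_r -> F)
    (V : 'M[F]_(s, r)) :
  linear (HRS_word alpha V).
Proof.
move=> c f g; apply/matrixP => i j.
by rewrite !mxE linearP hornerD hornerZ mulrDr mulrCA.
Qed.

HB.instance Definition _ (F : finFieldType) (s r : nat) (alpha : 'I_r -> F)
    (V : 'M[F]_(s, r)) :=
  GRing.isLinear.Build F {poly F} 'M[F]_(s, r) _ (HRS_word alpha V)
    (@HRS_word_is_linear F s r alpha V).

Lemma HRS_rVpoly (F : finFieldType) (s r : nat) (alpha : 'I_r -> F)
    (V : 'M[F]_(s, r)) k :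
  HRS k alpha V = [set (HRS_word alpha V \o rVpoly) u | u : 'rV_k].
Proof.
apply/setP => B; apply/imsetP/imsetP => -[f _ ->].
  by exists (poly_rV f); rewrite //= poly_rV_K // size_npoly.
exists (npolyp k (rVpoly f)) => //=.
by rewrite npolypK // size_poly.
Qed.

(** Row 0 suffices: it holds nonzero multiples of the values of a polynomial of degree < [r] at [r]
    distinct points, which cannot all vanish unless the polynomial does. *)
Lemma HRS_word_inj (F : finFieldType) (s r : nat) (alpha : 'I_r -> F)
    (V : 'M[F]_(s.+1, r)) :
  injective alpha -> (forall j, V ord0 j != 0) ->
  injective (HRS_word alpha V \o @rVpoly F r).
Proof.
move=> alpha_inj V0 u v /= /eqP; rewrite -subr_eq0 -!linearB /= => /eqP fw0.
apply/eqP; rewrite -subr_eq0 -[u - v]rVpolyK; set f := rVpoly (u - v) in fw0 *.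
suff -> : f = 0 by rewrite linear0.
apply/eqP/negPn/negP => nz_f.
suff: (size (codom alpha) < size f)%N.
  by rewrite size_codom card_ord ltnNge size_poly.
apply: max_poly_roots => //.
- apply/allP => _ /codomP[j ->]; rewrite /root.
  move/matrixP/(_ ord0 j)/eqP: fw0.
  by rewrite !mxE mulf_eq0 (negPf (V0 j)) nderivn0.
- exact/injectiveP.
Qed.

(** Multiplication by a generator [x] of the cyclic group [G] permutes the coset, so the sum [S]
    satisfies [x ^+ m * S = S], while [x ^+ m] differs from 1. *)
Lemma sum_expf_coset (F : finFieldType) (G : {group {unit F}}) (beta : F) m :
  beta != 0 -> ~~ (#|G| %| m)%N ->
  \sum_(a in [set beta * val g | g in G]) a ^+ m = 0.
Proof.
move=> beta0; have /cyclicP[x defG] := field_unit_group_cyclic G.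
have ->: #|G| = #[x]%g by rewrite defG.
rewrite order_dvdn => xm1; rewrite big_imset /=; last first.
  by move=> g h _ _ /(mulfI beta0) /val_inj.
set S := (X in X = _); have : val x ^+ m * S = S.
  rewrite mulr_sumr [RHS](reindex_inj (mulgI x)) /=.
  apply: eq_big => [g|g _]; first by rewrite groupMl // defG cycle_id.
  by rewrite -exprMn mulrCA.
move/eqP; rewrite -subr_eq0 -[X in _ - X]mul1r -mulrBl mulf_eq0 subr_eq0.
rewrite -FinRing.val_unitX -FinRing.val_unit1 (inj_eq val_inj) (negPf xm1).
by move=> /eqP.
Qed.

Lemma sum_sqr_deriv_coset (F : finFieldType) (p : nat) (G : {group {unit F}})
    (beta : F) (h : {poly F}) :
  beta != 0 -> p \in [pchar F] -> (p %| #|G| - 1)%N -> (size h < #|G|.*2)%N ->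
  \sum_(a in [set beta * val g | g in G]) a ^+ 2 * h^`().[a] = 0.
Proof.
move=> beta0 charF p_dvd lt_h; set A := imset _ _; set r := #|G| in p_dvd lt_h.
have r0 : (0 < r)%N := cardG_gt0 G.
have lt_h' : (size h^`()%R <= r.*2 - 2)%N.
  have : (size h^`()%R <= (size h).-1)%N by exact: size_poly.
  by lia.
transitivity (\sum_(a in A) \sum_(i < r.*2 - 2)
    h`_i.+1 *+ i.+1 * a ^+ i.+2).
  apply: eq_bigr => a _; rewrite (horner_coef_wide _ lt_h') mulr_sumr.
  by apply: eq_bigr => i _; rewrite coef_deriv mulrCA -exprD.
rewrite exchange_big big1 //= => i _; rewrite -mulr_sumr.
have [r_dvd|r_ndvd] := boolP (r %| i.+2)%N; last first.
  by rewrite sum_expf_coset ?mulr0.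
(* Here [2 <= i.+2 < 2 * r], so the only possible multiple of [r] is [r] itself. *)
have -> : i.+1 = (r - 1)%N.
  case/dvdnP: r_dvd => -[|[|k]] /=; have := ltn_ord i; rewrite -/r; nia.
have /eqP r1F : (r - 1)%:R == 0 :> F by rewrite -(dvdn_pcharf charF).
by rewrite -[_ *+ _]mulr_natr r1F mulr0 mul0r.
Qed.

Theorem theorem13 (F : finFieldType) (p r : nat) (G : {group {unit F}})
    (beta mu : F) (alpha : 'I_r -> F) (u : F -> F)
    (A := [set beta * val g | g in G])
    (V := \matrix_(i < 2, j < r)
            (if i == 0 then u (alpha j)
             else mu * alpha j ^+ 2 * (u (alpha j))^-1)) :
  #|G| = r ->
  beta != 0 ->
  p \in [pchar F] ->
  (p %| r - 1)%N ->
  mu != 0 ->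
  (forall a : F, a \in A -> u a != 0) ->
  injective alpha ->
  [set alpha j | j : 'I_r] = A ->
  rev_self_dual (HRS r alpha V).
Proof.
move=> cardG beta0 charF p_dvd _ u0 alpha_inj defA.
have u0_alpha j : u (alpha j) != 0 by rewrite u0 // -defA imset_f.
rewrite HRS_rVpoly; apply: rev_self_dual_image; first by rewrite mul2n addnn.
  by apply: HRS_word_inj => [|j] //; rewrite mxE; exact: u0_alpha.
move=> v w /=; set f := rVpoly v; set g := rVpoly w.
transitivity (\sum_(j < r) mu * (alpha j ^+ 2 * (f * g)^`().[alpha j])).
  (* Reversal pairs row 0 with row 1, so each [u (alpha j)] meets its inverse; the Leibniz rule
     merges the two terms. *)
  apply: eq_bigr => j _; rewrite big_ord_recl big_ord1 !mxE /=.
  rewrite !nderivn0 !nderivn1 derivM hornerD !hornerM.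
  by field; rewrite u0_alpha.
rewrite -mulr_sumr.
transitivity (mu * \sum_(a in A) a ^+ 2 * (f * g)^`().[a]).
  by rewrite -defA big_imset //= => x y _ _ /alpha_inj.
rewrite (@sum_sqr_deriv_coset _ p) ?mulr0 ?cardG //.
(* Positivity makes the bound [(r + r).-1] on the size of [f * g] strictly less than [2 * r]. *)
have r0 : (0 < r)%N by rewrite -cardG cardG_gt0.
have szf : (size f <= r)%N by exact: size_poly.
have szg : (size g <= r)%N by exact: size_poly.
have := size_polyMleq f g; lia.
Qed.
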